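(* For every integer $n \ge 4$, the Artin pure braid group $P_n$ is not residually free.
   Context: The Artin braid group $B_n$ has generators $\sigma_1,\dots,\sigma_{n-1}$ and relations $\sigma_i\sigma_{i+1}\sigma_i=\sigma_{i+1}\sigma_i\sigma_{i+1}$ for $1\le i\le n-2$ and $\sigma_j\sigma_i=\sigma_i\sigma_j$ for $|j-i|\ge 2$. The Artin pure braid group is $P_n=\ker(B_n\to\Sigma_n)$, the kernel of the natural map to the symmetric group $\Sigma_n$ sending $\sigma_i$ to the transposition $(i\ i{+}1)$. A group $G$ is residually free if for every $x\neq 1$ in $G$ there is a homomorphism $f$ from $G$ to a free group $F$ with $f(x)\neq 1$. *)

(* Defs.v *)
From HB Require Import structures.
From mathcomp Require Import all_boot all_fingroup.
From mathcomp Require Import boolp zify.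

Set Implicit Arguments.
Unset Strict Implicit.
Unset Printing Implicit Defensive.

Local Open Scope group_scope.
Local Open Scope quotient_scope.

Section Presentation.

(* The letter (x, true) stands for the generator x, and (x, false) for its
   inverse. *)
Definition word (X : Type) : Type := seq (X * bool).

Definition winv (X : Type) (w : word X) : word X :=
  rev [seq (a.1, ~~ a.2) | a <- w].

Variables (X : choiceType) (R : word X -> word X -> Prop).

(* The congruence generated by R and the cancellation of mutually inverse
   letters. *)
Inductive pres_eq : word X -> word X -> Prop :=
| PresRel u v of R u v : pres_eq u v
| PresCancel x b : pres_eq [:: (x, b); (x, ~~ b)] [::]
| PresCat u u' v v' of pres_eq u u' & pres_eq v v' :
    pres_eq (u ++ v) (u' ++ v')
| PresRefl u : pres_eq u u
| PresSym u v of pres_eq u v : pres_eq v u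
| PresTrans u v w of pres_eq u v & pres_eq v w : pres_eq u w.

Definition pres_eqb (u v : word X) : bool := `[< pres_eq u v >].

Lemma pres_eqb_refl : reflexive pres_eqb.
Proof. by move=> u; apply/asboolP/PresRefl. Qed.

Lemma pres_eqb_sym : symmetric pres_eqb.
Proof. by move=> u v; apply/asboolP/asboolP; apply: PresSym. Qed.

Lemma pres_eqb_trans : transitive pres_eqb.
Proof.
by move=> v u w /asboolP uv /asboolP vw; apply/asboolP; apply: PresTrans vw.
Qed.

Canonical pres_equiv :=
  EquivRel pres_eqb pres_eqb_refl pres_eqb_sym pres_eqb_trans.

(* The group < X | u = v for all u, v with R u v >. *)
Definition presented : Type := {eq_quot pres_equiv}.

HB.instance Definition _ := Choice.on presented.

Definition pclass (w : word X) : presented := \pi_({eq_quot pres_equiv}) w.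
Definition prepr (x : presented) : word X :=
  generic_quotient.repr (x : {eq_quot pres_equiv}).

Lemma preprK : cancel prepr pclass.
Proof. exact: reprK. Qed.

Lemma pclassP u v : pclass u = pclass v <-> pres_eq u v.
Proof. by split=> [/eqmodP/asboolP|uv] //; apply/eqmodP/asboolP. Qed.

Lemma pres_eq_repr w : pres_eq (prepr (pclass w)) w.
Proof. by apply/pclassP; rewrite preprK. Qed.

Lemma winv_cat (u v : word X) : winv (u ++ v) = winv v ++ winv u.
Proof. by rewrite /winv map_cat rev_cat. Qed.

Lemma winvK : involutive (@winv X).
Proof.
move=> w; rewrite /winv map_rev revK -map_comp -[RHS]map_id.
by apply: eq_map => -[x b] /=; rewrite negbK.
Qed.

Lemma pres_eq_mulV w : pres_eq (w ++ winv w) [::].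
Proof.
elim: w => [|[x b] w IHw]; first exact: PresRefl.
rewrite -cat1s winv_cat -catA [w ++ _]catA.
have step: pres_eq ((w ++ winv w) ++ winv [:: (x, b)]) [:: (x, ~~ b)].
  exact: (PresCat IHw (PresRefl _)).
exact: PresTrans (PresCat (PresRefl [:: (x, b)]) step) (PresCancel x b).
Qed.

Lemma pres_eq_mulg w : pres_eq (winv w ++ w) [::].
Proof. by rewrite -{2}[w]winvK; apply: pres_eq_mulV. Qed.

Lemma pres_eq_inv u v : pres_eq u v -> pres_eq (winv u) (winv v).
Proof.
move=> uv.
have h1 : pres_eq (winv u ++ (v ++ winv v)) (winv u).
  by rewrite -[X in pres_eq _ X]cats0; apply: PresCat (PresRefl _) (pres_eq_mulV v).
have h2 : pres_eq ((winv u ++ v) ++ winv v) (winv v).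
  apply: (@PresCat _ [::]); last exact: PresRefl.
  apply: PresTrans (pres_eq_mulg u).
  by apply: PresCat (PresRefl _) _; apply: PresSym.
by apply: PresTrans (PresSym h1) _; rewrite catA.
Qed.

Definition pone : presented := pclass [::].
Definition pmul (x y : presented) : presented := pclass (prepr x ++ prepr y).
Definition pinv (x : presented) : presented := pclass (winv (prepr x)).

Lemma pmulE u v : pmul (pclass u) (pclass v) = pclass (u ++ v).
Proof. by apply/pclassP; apply: PresCat; apply: pres_eq_repr. Qed.

Lemma pinvE w : pinv (pclass w) = pclass (winv w).
Proof. by apply/pclassP/pres_eq_inv/pres_eq_repr. Qed.

Lemma pmulA : associative pmul.
Proof.
by move=> x y z; rewrite -[x]preprK -[y]preprK -[z]preprK !pmulE catA.
Qed.

Lemma pmul1 : left_id pone pmul.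
Proof. by move=> x; rewrite -[x]preprK pmulE. Qed.

Lemma pmulr1 : right_id pone pmul.
Proof. by move=> x; rewrite -[x]preprK pmulE cats0. Qed.

Lemma pmulV : left_inverse pone pinv pmul.
Proof.
move=> x; rewrite -[x]preprK pinvE pmulE.
exact/pclassP/pres_eq_mulg.
Qed.

Lemma pmulrV : right_inverse pone pinv pmul.
Proof.
move=> x; rewrite -[x]preprK pinvE pmulE.
exact/pclassP/pres_eq_mulV.
Qed.

HB.instance Definition _ :=
  isGroup.Build presented pmulA pmul1 pmulr1 pmulV pmulrV.

Lemma pclassM u v : pclass u * pclass v = pclass (u ++ v).
Proof. exact: pmulE. Qed.

Lemma pclassV w : (pclass w)^-1 = pclass (winv w).
Proof. exact: pinvE. Qed.

Definition pgen (x : X) : presented := pclass [:: (x, true)].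

End Presentation.

Arguments pclass {X} R w.
Arguments prepr {X R} x.
Arguments pgen {X} R x.

Section Evaluation.

Variables (X : choiceType) (R : word X -> word X -> Prop).
Variables (G : groupType) (f : X -> G).

Definition weval (w : word X) : G :=
  \prod_(a <- w) (if a.2 then f a.1 else (f a.1)^-1).

Lemma weval_cat u v : weval (u ++ v) = weval u * weval v.
Proof. by rewrite /weval big_cat. Qed.

Hypothesis fR : forall u v, R u v -> weval u = weval v.

Lemma weval_pres_eq u v : pres_eq R u v -> weval u = weval v.
Proof.
elim=> {u v} [u v|x b|u u' v v' _ uu' _ vv'|//|//|u v w _ -> _ ->//].
- exact: fR.
- by rewrite /weval !big_cons big_nil mulg1 /=; case: b;
    rewrite /= ?mulgV ?mulVg.
- by rewrite !weval_cat uu' vv'.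
Qed.

(* The homomorphism extending f; the hypothesis fR makes it independent of the
   chosen representative. *)
Definition plift (x : presented R) : G := weval (prepr x).

Lemma plift_class w : plift (pclass R w) = weval w.
Proof. exact/weval_pres_eq/pres_eq_repr. Qed.

Lemma plift_gen x : plift (pgen R x) = f x.
Proof. by rewrite plift_class /weval big_seq1. Qed.

Lemma pliftM : {morph plift : x y / x * y}.
Proof.
by move=> x y; rewrite /plift -weval_cat; apply/weval_pres_eq/pres_eq_repr.
Qed.

Lemma plift1 : plift 1 = 1.
Proof. by rewrite [LHS]plift_class /weval big_nil. Qed.

End Evaluation.

Section Kernel.

Variables (G H : groupType) (f : UMagmaMorphism.type G H).

Definition ker_pred : pred G := fun x => f x == 1.

Definition kernel : Type := {x : G | ker_pred x}.

Lemma ker_closed : group_closed ker_pred.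
Proof.
split=> [|x y]; first by rewrite unfold_in /ker_pred gmulf1.
rewrite !unfold_in /ker_pred => /eqP fx /eqP fy.
by rewrite gmulfF fx fy divg1.
Qed.

HB.instance Definition _ := SubChoice.on kernel.
HB.instance Definition _ :=
  SubChoice_isSubGroup.Build G ker_pred kernel ker_closed.

End Kernel.

Definition free_group (X : choiceType) : groupType :=
  presented (fun _ _ : word X => False).

Definition residually_free (G : groupType) : Prop :=
  forall x : G, x != 1 ->
    exists (X : choiceType) (f : {multiplicative G -> free_group X}), f x != 1.

Section Braid.

Variable n : nat.

(* The i-th generator (counting from 0) is sigma_(i+1). *)
Definition sigma_word (i : 'I_n.-1) : word 'I_n.-1 := [:: (i, true)].

Inductive braid_rel : word 'I_n.-1 -> word 'I_n.-1 -> Prop :=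
| BraidAdj (i j : 'I_n.-1) of j = i.+1 :> nat :
    braid_rel (sigma_word i ++ sigma_word j ++ sigma_word i)
              (sigma_word j ++ sigma_word i ++ sigma_word j)
| BraidFar (i j : 'I_n.-1) of (i.+2 <= j) || (j.+2 <= i) :
    braid_rel (sigma_word j ++ sigma_word i) (sigma_word i ++ sigma_word j).

Definition braid_group : groupType := presented braid_rel.

Lemma gen_lt (i : 'I_n.-1) : i < n.
Proof. exact: leq_trans (ltn_ord i) (leq_pred n). Qed.

Lemma genS_lt (i : 'I_n.-1) : i.+1 < n.
Proof. by rewrite -ltn_predRL. Qed.

Definition adj_tperm (i : 'I_n.-1) : {perm 'I_n} :=
  tperm (Ordinal (gen_lt i)) (Ordinal (genS_lt i)).

Lemma adj_tperm_rel u v :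
  braid_rel u v -> weval adj_tperm u = weval adj_tperm v.
Proof.
case=> i j ij; rewrite !weval_cat /weval !big_seq1 /=.
  rewrite /adj_tperm.
  have -> : Ordinal (gen_lt j) = Ordinal (genS_lt i) by apply: val_inj.
  set a := Ordinal (gen_lt i); set b := Ordinal (genS_lt i).
  set c := Ordinal (genS_lt j).
  have ab : a != b by rewrite -val_eqE /= neq_ltn ltnSn.
  have ac : a != c by rewrite -val_eqE /= ij neq_ltn ltnS leqnSn.
  have bc : b != c by rewrite -val_eqE /= ij neq_ltn ltnSn.
  have -> : tperm a b * (tperm b c * tperm a b) = tperm a c.
    rewrite -{1}[tperm a b]tpermV -[LHS]/(tperm b c ^ tperm a b) tpermJ tpermR.
    by rewrite tpermD.
  rewrite -{1}[tperm b c]tpermV -[RHS]/(tperm a b ^ tperm b c) tpermJ tpermL.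
  by rewrite tpermD // eq_sym.
rewrite -[LHS]/(adj_tperm j * adj_tperm i) -[RHS]/(adj_tperm i * adj_tperm j).
apply: esym; rewrite conjgC; congr (_ * _).
rewrite /adj_tperm tpermJ !tpermD // -val_eqE /=;
  by case/orP: ij => ij; lia.
Qed.

(* The homomorphism B_n -> Sigma_n sending sigma_i to the transposition of i
   and i+1. *)
Definition braid_perm : braid_group -> {perm 'I_n} :=
  @plift _ braid_rel _ adj_tperm.

HB.instance Definition _ :=
  isMultiplicative.Build braid_group {perm 'I_n} braid_perm
    (pliftM adj_tperm_rel).
HB.instance Definition _ :=
  Multiplicative_isUMagmaMorphism.Build braid_group {perm 'I_n} braid_perm
    (plift1 adj_tperm_rel).

Lemma braid_perm_gen i : braid_perm (pgen braid_rel i) = adj_tperm i.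
Proof. exact: plift_gen adj_tperm_rel i. Qed.

Definition pure_braid_group : groupType := kernel braid_perm.

End Braid.

(* Main.v *)
Require Import Defs.
From HB Require Import structures.
From mathcomp Require Import all_boot all_order all_fingroup all_algebra.
From mathcomp Require Import boolp zify ring lra.

(** The proof exhibits one nontrivial pure braid, supported on the first four
    strands, that every homomorphism to a free group kills.

    Write A_ij for the standard pure braid in which strands i and j link once,
    and consider a homomorphism to a group in which noncentral elements have
    abelian centralizers.  A_14 and A_23 commute; suppose that both have
    noncentral images.  These images then share one abelian centralizer C.
    The full twist on strands i, j, k is a product of A_ij, A_ik and A_jk and
    commutes with all three.  If the full twist on 1, 2, 3, that on 1, 2, 4 or
    that on all four strands has a noncentral image, then A_12 and A_34 are
    mapped into C as well; if all three twists become central, then A_12 and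
    A_34 become inverse to the same element modulo the centre
    ([witness_eq1]).  So in every case the image of A_14, of A_23 or of
    A_12 A_34^-1 is central, or the images of A_12, A_14, A_23 and A_34 commute,
    and an iterated commutator that involves A_14, A_23 and A_12 A_34^-1 is
    killed: this is [witness].

    Free groups need not be shown to have abelian centralizers themselves: it
    is enough that every nontrivial element of a free group survives in some
    homomorphism to SL_2(Z) ([free_group_residually_SL2Z]), a group in which
    noncentral elements have abelian centralizers.  The homomorphism comes
    from ping-pong on the projective line.

    The witness is nontrivial because the braid group acts on the
    3-colourings of the strands in the sense of Fox, and the witness moves the
    colouring (0, 0, 0, 1) ([witness_colouring]). *)

Set Implicit Arguments.
Unset Strict Implicit.
Unset Printing Implicit Defensive.

Local Open Scope group_scope.

(** * Groups in which noncentral elements have abelian centralizers *)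

Section CentralizersAbelian.

Variable G : groupType.
Implicit Types x y z : G.

Definition central x : Prop := forall y, commute x y.

(** Commutation is transitive through noncentral elements; the centre is
    allowed because SL_2(Z) contains -1. *)
Definition centralizers_abelian : Prop :=
  forall y x z, ~ central y -> commute y x -> commute y z -> commute x z.

Lemma central_conj x y : central x -> x ^ y = x.
Proof. by move=> cx; rewrite conjgE cx mulKg. Qed.

Lemma centralM x y : central x -> central y -> central (x * y).
Proof.
by move=> cx cy z; apply/commute_sym/commuteM; apply: commute_sym.
Qed.

Lemma centralV x : central x -> central x^-1.
Proof. by move=> cx y; apply/commute_sym/commuteV/commute_sym. Qed.

Lemma commuteMr x y z : commute x (y * z) -> commute x z -> commute x y.
Proof.
by move=> xyz xz; rewrite -[y](mulgK z); apply: commuteM => //; apply: commuteV.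
Qed.

Lemma commg_eq1 x y : commute x y -> [~ x, y] = 1.
Proof. by move/monoid.commgP/eqP. Qed.

(** When x, y, z are the linking braids of three strands, x y z is their full
    twist, which is central in the pure braid group of these strands. *)
Definition twist_commutes x y z : Prop :=
  [/\ commute (x * y * z) x, commute (x * y * z) y & commute (x * y * z) z].

Lemma twist_commutes_conj g x y z :
  twist_commutes x y z -> twist_commutes (x ^ g) (y ^ g) (z ^ g).
Proof.
rewrite /twist_commutes -!conjMg => -[tx ty tz].
by split; rewrite /commute -!conjMg; congr (_ ^ _).
Qed.

(** A commutator dies when one of its arguments is central or its arguments
    commute; nesting combines the three ways in which a homomorphism may
    degenerate.  Without the conjugation by a12 the element would act trivially
    on the 3-colourings that detect it below. *)
Definition witness a12 a14 a23 a34 : G :=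
  [~ a14, [~ a23 ^ a12, a12 * a34^-1]].

(** Suppose that a14 and a23 are noncentral.  Since they commute, the
    centralizer C of a14 is abelian and contains that of a23.  The twists
    a24 a14 a12 and a34 a24 a23 commute with a14 and a23 respectively, so they
    lie in C, and if a12 is in C, then so are a24 and a34.  A noncentral element
    that commutes with a12 and with a14 or a23 puts a12 in C; this applies to
    the twists on 123, on 124 and on all strands.  If these three are central,
    then so is a12 a34^-1. *)
Lemma witness_eq1 a12 a13 a14 a23 a24 a34
    (z := a34 * a24 * a14 * (a23 * a13 * a12)) :
    centralizers_abelian ->
    commute a14 a23 ->
    twist_commutes a23 a13 a12 -> twist_commutes a24 a14 a12 ->
    twist_commutes a34 a24 a23 -> commute z a12 -> commute z a14 ->
  witness a12 a14 a23 a34 = 1.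
Proof.
move=> caG a14_23 [t23 t13 t12] [u24 u14 u12] [w34 w24 w23].
rewrite {}/z => z12 z14.
have [c14|n14] := pselect (central a14); first by apply: commg_eq1; apply: c14.
have [c23|n23] := pselect (central a23).
  apply: commg_eq1; rewrite (central_conj _ c23) commg_eq1.
    exact: commute1.
  exact: c23.
have [cD|nD] := pselect (central (a12 * a34^-1)).
  apply: commg_eq1; rewrite commg_eq1; first exact: commute1.
  exact/commute_sym/cD.
have from23 x : commute a23 x -> commute a14 x.
  by apply: caG => //; apply: commute_sym.
have abelian_case : commute a14 a12 -> commute a14 a34 ->
    [~ a14, [~ a23 ^ a12, a12 * a34^-1]] = 1.
  move=> c12 c34; apply: commg_eq1; rewrite commg_eq1; first exact: commute1.
  apply: (caG a14) => //; last by apply: commuteM => //; apply: commuteV.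
  by rewrite conjgE; do 2?[apply: commuteM => //]; apply: commuteV.
have t124 : commute a14 (a24 * a14 * a12) by apply: commute_sym.
have t234 : commute a14 (a34 * a24 * a23) by apply/from23/commute_sym.
have by12 : commute a14 a12 -> witness a12 a14 a23 a34 = 1.
  move=> c12; have c24 : commute a14 a24.
    by apply: commuteMr (commuteMr t124 c12) _.
  by apply: abelian_case => //; apply: commuteMr (commuteMr t234 a14_23) c24.
have [c123|n123] := pselect (central (a23 * a13 * a12)); last first.
  by apply/by12/from23; apply: caG n123 _ _.
have [c124|n124] := pselect (central (a24 * a14 * a12)); last first.
  by apply: by12; apply: caG n124 _ _.
have [cfull|nfull] := pselect (central (a34 * a24 * a14 * (a23 * a13 * a12)));
  last first.
  by apply: by12; apply: caG nfull _ _.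
(* Modulo the centre both a12 and a34 are inverse to p = a24 a14. *)
case: nD; set p := a24 * a14.
have cu : central (a34 * p).
  rewrite /p mulgA -[a34 * _ * _](mulgK (a23 * a13 * a12)).
  apply: centralM; [exact: cfull|exact: centralV].
have -> : a12 * a34^-1 = p * a12 * (a34 * p)^-1.
  have pC : p * a12 = a12 * p.
    by apply: (mulgI p); rewrite -(c124 p) -(mulgA p a12 p).
  by rewrite pC invgM (mulgA (a12 * p)) mulgK.
by apply: centralM => //; apply: centralV.
Qed.

End CentralizersAbelian.

Lemma gmulf_witness (G H : groupType) (f : UMagmaMorphism.type G H)
    (a12 a14 a23 a34 : G) :
  f (witness a12 a14 a23 a34) = witness (f a12) (f a14) (f a23) (f a34).
Proof. by rewrite /witness !(gmulfR, gmulfJ, gmulfM, gmulfV). Qed.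

(** * Pure braids on four strands *)

(** Here a, b, c stand for three consecutive Artin generators.  The squares
    A_12 = a^2, A_23 = b^2 and A_34 = c^2 and their conjugates A_13 = A_12^b,
    A_24 = A_23^c and A_14 = A_12^(bc) are the linking braids. *)
Section ThreeStrands.

Variables (G : groupType) (a b : G).
Hypothesis aba : a * b * a = b * a * b.

Lemma braid_mid x : x * a * b * a = x * b * a * b.
Proof. by rewrite -!(mulgA x) aba !mulgA. Qed.

Lemma braid_conj : a ^ (b * a) = b.
Proof. by apply: (mulgI (b * a)); rewrite conjgE mulVKg mulgA. Qed.

Lemma three_strand_twistE :
  b ^+ 2 * (a ^+ 2) ^ b * a ^+ 2 = a * b * a * (a * b * a).
Proof.
rewrite conjgE !expg2 !mulgA mulgK.
by rewrite [in RHS]aba -[b * a * b * a * b in RHS]braid_mid braid_mid.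
Qed.

(** Conjugation by the half twist aba exchanges a and b, so its square is
    central. *)
Lemma full_twist_commute :
  let z := a * b * a * (a * b * a) in commute z a /\ commute z b.
Proof.
have sa : a * (a * b * a) = a * b * a * b by rewrite {1}aba !mulgA.
have sb : b * (a * b * a) = a * b * a * a by rewrite !mulgA -aba.
by split; apply: commute_sym;
  rewrite /commute mulgA ?sa ?sb -!(mulgA (a * b * a)) ?sa ?sb.
Qed.

Lemma three_strand_twist : twist_commutes (b ^+ 2) ((a ^+ 2) ^ b) (a ^+ 2).
Proof.
rewrite /twist_commutes three_strand_twistE.
have [za zb] := full_twist_commute.
by split; rewrite ?conjgE; do ?[apply: commuteM]; try apply: commuteV;
  try apply: commuteX.
Qed.

Lemma commute_baab : commute a (b * a * a * b).
Proof. by rewrite /commute !mulgA aba -braid_mid. Qed.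

End ThreeStrands.

Section FourStrands.

Variables (G : groupType) (a b c : G).
Hypotheses (aba : a * b * a = b * a * b) (bcb : b * c * b = c * b * c).
Hypothesis ac : commute a c.

(** Since b = c^(bc), the pair is conjugate to a^2, c^2. *)
Lemma commute_14_23 : commute ((a ^+ 2) ^ (b * c)) (b ^+ 2).
Proof.
rewrite -[in b ^+ 2](braid_conj (esym bcb)) -conjXg /commute -!conjMg.
congr (_ ^ _); exact: commuteX2.
Qed.

Lemma conj_a_c : (a ^+ 2) ^ c = a ^+ 2.
Proof. by rewrite conjgE (commute_sym (commuteX 2 (commute_sym ac))) mulKg. Qed.

(** Conjugating by c replaces strand 3 by strand 4 in the twist on 123. *)
Lemma twist_124 :
  twist_commutes ((b ^+ 2) ^ c) ((a ^+ 2) ^ (b * c)) (a ^+ 2).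
Proof.
have := twist_commutes_conj c (three_strand_twist aba).
by rewrite -conjgM conj_a_c.
Qed.

Lemma last_strand_twistE :
  c ^+ 2 * (b ^+ 2) ^ c * (a ^+ 2) ^ (b * c) = c * (b * a * a * b) * c.
Proof. by rewrite conjgM !conjgE !expg2 !mulgA !mulgK. Qed.

(** The full twist on four strands factors as a turn of the last strand around
    the other three, c baab c, and the full twist (aba)^2 of these. *)
Lemma four_strand_twist
    (z := c ^+ 2 * (b ^+ 2) ^ c * (a ^+ 2) ^ (b * c) *
          (b ^+ 2 * (a ^+ 2) ^ b * a ^+ 2)) :
  [/\ commute z a, commute z b & commute z c].
Proof.
rewrite {}/z last_strand_twistE three_strand_twistE //.
have [za zb] := full_twist_commute aba.
set z := _ * (a * b * a) in za zb *.
split.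
- apply/commute_sym/commuteM; last exact: commute_sym.
  by do 2?[apply: commuteM] => //; apply: commute_baab.
- apply/commute_sym/commuteM; last exact: commute_sym.
  rewrite /commute !mulgA bcb -(mulgA _ c a) -ac mulgA -(mulgA _ c a) -ac mulgA.
  by rewrite -(braid_mid bcb).
(* Cancelling the leading c leaves the commutation of c with baab c baab aa. *)
have zE : z = b * a * a * b * (a * a).
  by rewrite /z -(three_strand_twistE aba) conjgE !expg2 !mulgA mulgK.
have acc : commute c (a * a) by apply: commuteM; apply: commute_sym.
have cv : commute c (b * a * a * b * c * (b * a * a * b)).
  have acx x : x * a * c = x * c * a by rewrite -!mulgA ac.
  have aabaab x : x * a * a * b * a * a * b = x * b * a * a * b * a * a.
    have /commute_sym aS := commute_baab aba.
    by have := congr1 ( *%g x) (esym (commuteM aS aS)); rewrite !mulgA.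
  rewrite /commute !mulgA (braid_mid bcb) !acx -bcb.
  rewrite (braid_mid bcb) !acx.
  rewrite -(acx (b * c * a * a * b)) -(acx (b * c * a * a * b * a)).
  by rewrite -(braid_mid bcb) aabaab !acx.
rewrite /commute zE -!mulgA; congr (c * _); rewrite !mulgA.
have := commuteM cv acc; rewrite /commute !mulgA => ->.
by [].
Qed.

End FourStrands.

(** * The group SL_2(Z) *)

Section SL2.

Import GRing.Theory.
Local Open Scope ring_scope.

Definition SL2Z : Type := {A : 'M[int]_2 | \det A == 1}.

HB.instance Definition _ := SubChoice.on SL2Z.

Fact SL2Z_mul_subproof (A B : SL2Z) : \det (val A *m val B) == 1.
Proof. by rewrite det_mulmx (eqP (valP A)) (eqP (valP B)) mulr1. Qed.

Fact SL2Z_one_subproof : \det (1%:M : 'M[int]_2) == 1.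
Proof. by rewrite det1. Qed.

Fact SL2Z_inv_subproof (A : SL2Z) : \det (invmx (val A)) == 1.
Proof. by rewrite det_inv (eqP (valP A)) invr1. Qed.

Definition SL2Z_mul (A B : SL2Z) : SL2Z :=
  exist _ (val A *m val B) (SL2Z_mul_subproof A B).
Definition SL2Z_one : SL2Z := exist _ 1%:M SL2Z_one_subproof.
Definition SL2Z_inv (A : SL2Z) : SL2Z :=
  exist _ (invmx (val A)) (SL2Z_inv_subproof A).

Lemma SL2Z_unit (A : SL2Z) : val A \in unitmx.
Proof. by rewrite unitmxE (eqP (valP A)) unitr1. Qed.

Fact SL2Z_mulA : associative SL2Z_mul.
Proof. by move=> A B C; apply: val_inj; rewrite /= mulmxA. Qed.

Fact SL2Z_mul1 : left_id SL2Z_one SL2Z_mul.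
Proof. by move=> A; apply: val_inj; rewrite /= mul1mx. Qed.

Fact SL2Z_mulr1 : right_id SL2Z_one SL2Z_mul.
Proof. by move=> A; apply: val_inj; rewrite /= mulmx1. Qed.

Fact SL2Z_mulV : left_inverse SL2Z_one SL2Z_inv SL2Z_mul.
Proof. by move=> A; apply: val_inj; rewrite /= mulVmx ?SL2Z_unit. Qed.

Fact SL2Z_mulrV : right_inverse SL2Z_one SL2Z_inv SL2Z_mul.
Proof. by move=> A; apply: val_inj; rewrite /= mulmxV ?SL2Z_unit. Qed.

HB.instance Definition _ :=
  isGroup.Build SL2Z SL2Z_mulA SL2Z_mul1 SL2Z_mulr1 SL2Z_mulV SL2Z_mulrV.

Lemma val_SL2ZM (A B : SL2Z) : val (A * B)%g = val A *m val B.
Proof. by []. Qed.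

Lemma mulmx2E (A B : 'M[int]_2) i j :
  (A *m B) i j = A i 0 * B 0 j + A i 1 * B 1 j.
Proof.
by rewrite mxE big_ord_recl big_ord1; congr (_ + A _ _ * B _ _); apply: val_inj.
Qed.

Lemma mx2P (A B : 'M[int]_2) :
  A 0 0 = B 0 0 -> A 0 1 = B 0 1 -> A 1 0 = B 1 0 -> A 1 1 = B 1 1 -> A = B.
Proof.
move=> e00 e01 e10 e11; apply/matrixP=> i j.
have two (k : 'I_2) : k = 0 \/ k = 1.
  by case: k => [[|[|[]]]] //= lt; [left|right]; apply: val_inj.
by case: (two i) (two j) => -> [] ->.
Qed.

(** Two matrices commute exactly when the vectors formed by their entries 01,
    10 and the difference of the diagonal entries are parallel. *)
Lemma commute_SL2ZP (A B : SL2Z) (dA := val A 0 0 - val A 1 1)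
    (dB := val B 0 0 - val B 1 1) :
  commute A B <->
  [/\ val A 0 1 * val B 1 0 = val A 1 0 * val B 0 1,
      val A 0 1 * dB = dA * val B 0 1 & val A 1 0 * dB = dA * val B 1 0].
Proof.
rewrite {}/dA {}/dB.
split=> [AB|[e1 e2 e3]].
  have e i j : (val A *m val B) i j = (val B *m val A) i j.
    by have /(congr1 val)/matrixP/(_ i j) := AB.
  move: (e 0 0) (e 0 1) (e 1 0); rewrite !mulmx2E => e00 e01 e10.
  by split; lra.
apply: val_inj => /=; apply: mx2P; rewrite !mulmx2E; lra.
Qed.

Lemma parallel_trans (p q r x y z x' y' z' : int) : p != 0 ->
    p * y = q * x -> p * z = r * x -> q * z = r * y ->
    p * y' = q * x' -> p * z' = r * x' -> q * z' = r * y' ->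
  [/\ x * y' = y * x', x * z' = z * x' & y * z' = z * y'].
Proof.
move=> p0 a1 a2 a3 c1 c2 c3; split; apply: (mulfI p0).
- by have := congr1 ( *%R x) c1; have := congr1 ( *%R x') a1; lra.
- by have := congr1 ( *%R x) c2; have := congr1 ( *%R x') a2; lra.
- have := congr1 ( *%R z') a1; have := congr1 ( *%R y') a2.
  by have := congr1 ( *%R x) c3; lra.
Qed.

(** Being parallel is transitive through a nonzero vector, and the vector of a
    matrix vanishes only if the matrix is scalar, hence central. *)
Lemma SL2Z_centralizers_abelian : centralizers_abelian SL2Z.
Proof.
move=> B A C ncB /commute_SL2ZP[a1 a2 a3] /commute_SL2ZP[c1 c2 c3].
have nz : [|| val B 0 1 != 0, val B 1 0 != 0 | val B 0 0 - val B 1 1 != 0].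
  apply: contra_notT ncB.
  rewrite !negb_or !negbK => /and3P[/eqP p /eqP q /eqP r] D.
  by apply/commute_SL2ZP; rewrite p q r !mul0r.
apply/commute_SL2ZP.
move: (val A 0 1) (val A 1 0) (val A 0 0 - _)
   (val C 0 1) (val C 1 0) (val C 0 0 - _)
   (val B 0 1) (val B 1 0) (val B 0 0 - _) a1 a2 a3 c1 c2 c3 nz.
move=> x y z x' y' z' p q r a1 a2 a3 c1 c2 c3 /or3P[] nz.
- exact: (parallel_trans nz a1 a2 a3 c1 c2 c3).
- by have [] := @parallel_trans q p r y x z y' x' z' nz; rewrite -?a1 -?c1.
- by have [] := @parallel_trans r p q z x y z' x' y' nz;
    rewrite -?a2 -?c2 -?a3 -?c3.
Qed.

End SL2.

(** * Ping-pong *)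

Section ReducedWords.

Variable X : choiceType.

Definition letter_inv (a : X * bool) : X * bool := (a.1, ~~ a.2).

Definition reduced (w : word X) : bool :=
  sorted (fun a b => b != letter_inv a) w.

Lemma reduced_repr (w : word X) :
  exists2 r, reduced r & pres_eq (fun _ _ : word X => False) w r.
Proof.
elim: w => [|a w [r red_r wr]]; first by exists [::] => //; apply: PresRefl.
have awr : pres_eq (fun _ _ : word X => False) (a :: w) (a :: r).
  by rewrite -[a :: w]cat1s -[a :: r]cat1s; apply: PresCat wr; apply: PresRefl.
case: r red_r {wr} awr => [|b r] red_r awr; first by exists [:: a].
have [ba|nba] := eqVneq b (letter_inv a); last first.
  by exists [:: a, b & r]; rewrite //= nba.
exists r; first exact: path_sorted red_r.
apply: PresTrans awr _; rewrite ba -[X in pres_eq _ _ X]cat0s.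
rewrite -[a :: _]/([:: a; letter_inv a] ++ r).
apply: (PresCat _ (PresRefl _ r)); case: a {ba} => x c; exact: PresCancel.
Qed.

End ReducedWords.

Section PingPong.

Import Order.TTheory GRing.Theory Num.Theory.
Local Open Scope ring_scope.

Lemma det2 (A : 'M[int]_2) : \det A = A 0 0 * A 1 1 - A 0 1 * A 1 0.
Proof.
rewrite (expand_det_row _ 0) big_ord_recl big_ord1 /cofactor !det_mx11 !mxE /=.
rewrite expr0 expr1 mul1r mulN1r mulrN.
by congr (_ * A _ _ - A _ _ * A _ _); apply: val_inj.
Qed.

(** The matrix of the transformation z |-> p - 1 / (z - q), which throws the
    complement of the unit disc around q into the unit disc around p. *)
Definition swing_mx (p q : int) : 'M[int]_2 :=
  \matrix_(i, j) if i == 0 then (if j == 0 then p else - 1 - p * q)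
                 else (if j == 0 then 1 else - q).

Fact swing_subproof p q : \det (swing_mx p q) == 1.
Proof. by rewrite det2 !mxE /=; apply/eqP; ring. Qed.

Definition swing p q : SL2Z := exist _ (swing_mx p q) (swing_subproof p q).

(** Up to sign, inverting exchanges the two discs. *)
Lemma swingV p q : val (swing p q)^-1%g = - swing_mx q p.
Proof.
rewrite /=; apply: (can_inj (mulKmx (SL2Z_unit (swing p q)))).
rewrite mulmxV ?SL2Z_unit //; apply: mx2P; rewrite mulmx2E !mxE /=; ring.
Qed.

(** The first column (u, v) of A is the image of the point at infinity; the
    predicate says that u / v is at distance at most 1 from c, without
    dividing. *)
Definition in_disc (c : int) (A : SL2Z) : Prop :=
  val A 1 0 != 0 /\ `|val A 0 0 - c * val A 1 0| <= `|val A 1 0|.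

Lemma swing_in_disc p q c A :
  2 <= `|c - q| -> in_disc c A ->
  in_disc p (swing p q * A)%g /\ in_disc p ((swing q p)^-1 * A)%g.
Proof.
rewrite /in_disc !val_SL2ZM => cq [v0 uv].
rewrite !mulmx2E swingV !mxE /=.
move: (val A 0 0) (val A 1 0) v0 uv => u v v0 uv.
have far : `|v| <= `|u - q * v|.
  have -> : u - q * v = (c - q) * v + (u - c * v) by ring.
  apply: le_trans (lerB_normD _ _); rewrite normrM.
  have : 2 * `|v| <= `|c - q| * `|v| by rewrite ler_wpM2r.
  lra.
have nz : u - q * v != 0 by rewrite -normr_gt0 (lt_le_trans _ far) ?normr_gt0.
split; split.
- by rewrite mul1r mulNr.
- by rewrite mul1r mulNr [X in `|X| <= _](_ : _ = - v) ?normrN //; ring.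
- by rewrite mulN1r opprK mulrC -oppr_eq0 opprD opprK mulrC.
- rewrite [X in `|X| <= _](_ : _ = v); last ring.
  by rewrite [X in _ <= `|X|](_ : _ = - (u - q * v)) ?normrN //; ring.
Qed.

Variables (X : choiceType) (s : seq X).

(** Distinct even integers for the letters over s, so that the unit discs
    around them have disjoint interiors.  Generators outside s share the
    index size s; a word over s does not see them. *)
Definition disc_center (a : X * bool) : int := (4 * index a.1 s + 2 * a.2)%N%:Z.

Lemma disc_center_far a b :
  a.1 \in s -> b.1 \in s -> a != b -> 2 <= `|disc_center a - disc_center b|.
Proof.
case: a b => [x c] [y d] /= xs ys.
have [<-|xy] := eqVneq x y; rewrite /disc_center /=.
  by case: c d => [] [] //=; rewrite ?eqxx // => _; lia.
have : index x s != index y s.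
  by apply: contra xy => /eqP e; rewrite -(nth_index x xs) e nth_index.
by move=> ne _; case: c d => [] [] /=; lia.
Qed.

Definition generator_swing (x : X) : SL2Z :=
  swing (disc_center (x, true)) (disc_center (x, false)).

(** Ping-pong: in a reduced word the disc reached so far belongs to a letter
    other than the inverse of the next one, so that the next letter throws it
    into its own disc. *)
Lemma reduced_in_disc (a : X * bool) (w : word X) :
  all (fun b => b.1 \in s) (a :: w) -> reduced (a :: w) ->
  in_disc (disc_center a) (weval generator_swing (a :: w)).
Proof.
have step b c A : 2 <= `|c - disc_center (letter_inv b)| -> in_disc c A ->
    in_disc (disc_center b)
      ((if b.2 then generator_swing b.1 else (generator_swing b.1)^-1) * A)%g.
  case: b => x d far inA.
  have [] := swing_in_disc (disc_center (x, d)) far inA.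
  by case: d far; rewrite /generator_swing.
elim: w a => [|b w IHw] a.
  move=> _ _; rewrite /weval big_seq1 -[X in in_disc _ X]mulg1.
  (* The column (1, 0), the point at infinity, lies in no disc. *)
  case: a => x c; rewrite /in_disc val_SL2ZM mulmx1 /generator_swing.
  by case: c; rewrite ?swingV !mxE /= ?oppr0 ?mulr1 ?mulrN1 ?opprK ?subrr
    ?addNr ?normr0.
move=> /= /andP[a_s bw_s] /andP[ba red].
rewrite /weval big_cons; apply: step (IHw b bw_s red).
by apply: disc_center_far => //; case/andP: bw_s.
Qed.

Lemma weval_reduced_neq1 (w : word X) :
  w != [::] -> all (fun b => b.1 \in s) w -> reduced w ->
  weval generator_swing w != 1%g.
Proof.
case: w => // a w _ w_s red; apply: contraTneq isT => w1.
by have [] := reduced_in_disc w_s red; rewrite w1 /= mxE.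
Qed.

End PingPong.

Local Open Scope group_scope.

(** The homomorphism depends on x: only the finitely many generators of a
    reduced word for x need discs of their own. *)
Lemma free_group_residually_SL2Z (X : choiceType) (x : free_group X) :
  x != 1 -> exists h : {multiplicative free_group X -> SL2Z}, h x != 1.
Proof.
move=> x1.
pose R := fun _ _ : word X => False.
have [r red_r xr] := reduced_repr (@prepr X R x).
pose f := generator_swing (unzip1 r).
have fR u v : R u v -> weval f u = weval f v by [].
pose h : free_group X -> SL2Z := @plift X R SL2Z f.
have hM : {morph h : y z / y * z} by exact: (pliftM fR).
pose H : {multiplicative free_group X -> SL2Z} :=
  HB.pack_for {multiplicative free_group X -> SL2Z} h
    (isMultiplicative.Build _ _ h hM).
exists H; change (h x != 1); rewrite /h /plift (weval_pres_eq fR xr).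
apply: weval_reduced_neq1 => //.
  apply: contra_neq x1 => r0; rewrite -[x]preprK; apply/pclassP.
  by rewrite -r0.
by apply/allP => b br; apply: map_f.
Qed.

(** * Fox colourings *)

Section Crossings.

Import GRing.Theory.

Variable n : nat.
Local Open Scope ring_scope.

Definition colouring : finType := {ffun 'I_n -> 'Z_3}.

(** At a crossing of strands p and q the arc that passes under gets the colour
    that makes the colour of the arc above the mean of the other two. *)
Definition recolour (p q : 'I_n) (x : colouring) : colouring :=
  [ffun j => if j == p then x q else if j == q then x q + x q - x p else x j].

Lemma recolour_inj p q : p != q -> injective (recolour p q).
Proof.
move=> pq x y /ffunP xy; apply/ffunP=> j.
have := xy p; rewrite !ffunE eqxx => xyq.
have := xy q; rewrite !ffunE eq_sym (negbTE pq) eqxx xyq => /addrI/oppr_inj xyp.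
have [->//|jp] := eqVneq j p; have [->//|jq] := eqVneq j q.
by have := xy j; rewrite !ffunE (negbTE jp) (negbTE jq).
Qed.

Lemma recolour_braid p q r x : p != q -> p != r -> q != r ->
  recolour p q (recolour q r (recolour p q x)) =
  recolour q r (recolour p q (recolour q r x)).
Proof.
move=> pq pr qr; have [qp rp rq] : [/\ q != p, r != p & r != q].
  by rewrite ![_ == p]eq_sym (eq_sym r).
apply/ffunP=> j; rewrite !ffunE !eqxx.
rewrite ?(negbTE pq) ?(negbTE pr) ?(negbTE qr).
rewrite ?(negbTE qp) ?(negbTE rp) ?(negbTE rq).
have [->|_] := eqVneq j p; first by rewrite (negbTE pq) (negbTE pr).
have [_|_] := eqVneq j q; first by ring.
by have [_|_] := eqVneq j r; first by ring.
Qed.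

Lemma recolour_far p q r s x :
  p != r -> p != s -> q != r -> q != s ->
  recolour p q (recolour r s x) = recolour r s (recolour p q x).
Proof.
move=> pr ps qr qs; apply/ffunP=> j; rewrite !ffunE.
rewrite !(eq_sym r) !(eq_sym s).
rewrite ?(negbTE pr) ?(negbTE ps) ?(negbTE qr) ?(negbTE qs).
have [->|jp] := eqVneq j p; first by rewrite (negbTE pr) (negbTE ps).
have [->|jq] := eqVneq j q; first by rewrite (negbTE qr) (negbTE qs).
by [].
Qed.

Lemma gen_neq (i : 'I_n.-1) : Ordinal (gen_lt i) != Ordinal (genS_lt i).
Proof. by rewrite -val_eqE /= neq_ltn leqnn. Qed.

Definition crossing (i : 'I_n.-1) : {perm colouring} :=
  perm (recolour_inj (gen_neq i)).

Lemma crossing_rel u v : braid_rel u v -> weval crossing u = weval crossing v.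
Proof.
case=> i j ij; rewrite !weval_cat /weval !big_seq1 /=; apply/permP=> x;
  rewrite !permM !permE.
  have qE : Ordinal (gen_lt j) = Ordinal (genS_lt i) by apply: val_inj.
  have := gen_neq j; rewrite qE => qr.
  by apply: recolour_braid => //; [exact: gen_neq| rewrite -val_eqE /= ; lia].
by apply: recolour_far; rewrite -val_eqE /=; lia.
Qed.

Definition braid_colouring : braid_group n -> {perm colouring} :=
  @plift _ (@braid_rel n) _ crossing.

HB.instance Definition _ :=
  isMultiplicative.Build (braid_group n) {perm colouring} braid_colouring
    (pliftM crossing_rel).
HB.instance Definition _ :=
  Multiplicative_isUMagmaMorphism.Build (braid_group n) {perm colouring}
    braid_colouring (plift1 crossing_rel).

Lemma braid_colouring_gen i :
  braid_colouring (pgen (@braid_rel n) i) = crossing i.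
Proof. exact: plift_gen crossing_rel i. Qed.

End Crossings.

Section Computation.

Import GRing.Theory.

Variable n : nat.
Hypothesis n4 : 4 <= n.

Definition quad : Type := 'Z_3 * 'Z_3 * 'Z_3 * 'Z_3.

Definition move : Type := (quad -> quad) * (quad -> quad).

Definition pad (s : quad) : colouring n :=
  let: (x, y, z, t) := s in [ffun j : 'I_n => nth 0%R [:: x; y; z; t] j].

(** Permutations of a type whose size depends on n do not compute; tracking
    their action on padded quadruples, and that of their inverses, reduces the
    evaluation of a group word to functions on quadruples, which do. *)
Definition tracks (p : {perm colouring n}) (F : move) :=
  forall s, p (pad s) = pad (F.1 s) /\ p^-1 (pad s) = pad (F.2 s).

Definition mulF (F K : move) : move := (K.1 \o F.1, F.2 \o K.2).
Definition invF (F : move) : move := (F.2, F.1).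
Definition conjF (F K : move) : move := mulF (invF K) (mulF F K).
Definition commF (F K : move) : move := mulF (invF F) (conjF F K).

Lemma tracksM p q F K : tracks p F -> tracks q K -> tracks (p * q) (mulF F K).
Proof.
move=> pF qK s; rewrite invMg !permM /=.
have [-> _] := pF s; have [_ ->] := qK s.
by have [-> _] := qK (F.1 s); have [_ ->] := pF (K.2 s).
Qed.

Lemma tracksV p F : tracks p F -> tracks p^-1 (invF F).
Proof. by move=> pF s; rewrite invgK; have [] := pF s. Qed.

Lemma tracksJ p q F K : tracks p F -> tracks q K -> tracks (p ^ q) (conjF F K).
Proof. by move=> pF qK; do 2?apply: tracksM => //; apply: tracksV. Qed.

Lemma tracksR p q F K : tracks p F -> tracks q K -> tracks [~ p, q] (commF F K).
Proof. by move=> pF qK; apply: tracksM; [apply: tracksV|apply: tracksJ]. Qed.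

Local Open Scope ring_scope.

Definition move0 : move :=
  (fun s => let: (x, y, z, t) := s in (y, y + y - x, z, t),
   fun s => let: (x, y, z, t) := s in (x + x - y, x, z, t)).
Definition move1 : move :=
  (fun s => let: (x, y, z, t) := s in (x, z, z + z - y, t),
   fun s => let: (x, y, z, t) := s in (x, y + y - z, y, t)).
Definition move2 : move :=
  (fun s => let: (x, y, z, t) := s in (x, y, t, t + t - z),
   fun s => let: (x, y, z, t) := s in (x, y, z + z - t, z)).

Lemma tracks_crossing (i : 'I_n.-1) F :
  (forall s, crossing i (pad s) = pad (F.1 s)) -> cancel F.2 F.1 ->
  tracks (crossing i) F.
Proof.
move=> iF FK s; split; first exact: iF.
by rewrite -{1}(FK s) -iF permK.
Qed.

Variables i0 i1 i2 : 'I_n.-1.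
Hypotheses (i0E : i0 = 0%N :> nat) (i1E : i1 = 1%N :> nat).
Hypothesis i2E : i2 = 2%N :> nat.

Lemma tracks_moves :
  [/\ tracks (crossing i0) move0, tracks (crossing i1) move1
    & tracks (crossing i2) move2].
Proof.
split; apply: tracks_crossing => [[[[x y] z] t]|[[[x y] z] t]] /=;
  try by congr (_, _, _, _); ring.
all: rewrite permE; apply/ffunP => j; rewrite !ffunE -!val_eqE /=.
all: rewrite ?i0E ?i1E ?i2E.
all: by case: j => [[|[|[|[|j]]]] lt].
Qed.

Lemma witness_colouring
    (a := crossing i0) (b := crossing i1) (c := crossing i2) :
  (witness (a ^+ 2) ((a ^+ 2) ^ (b * c)) (b ^+ 2) (c ^+ 2) != 1)%g.
Proof.
have [t0 t1 t2] := tracks_moves.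
pose sqF F := mulF F F.
pose wF := commF (conjF (sqF move0) (mulF move1 move2))
  (commF (conjF (sqF move1) (sqF move0)) (mulF (sqF move0) (invF (sqF move2)))).
have tw :
    tracks (witness (a ^+ 2) ((a ^+ 2) ^ (b * c)) (b ^+ 2) (c ^+ 2))%g wF.
  apply: tracksR; first by apply: tracksJ; apply: tracksM.
  apply: tracksR; first by apply: tracksJ; apply: tracksM.
  by apply: tracksM; [|apply: tracksV]; apply: tracksM.
apply: contraTneq isT => w1.
have [+ _] := tw (0, 0, 0, 1); rewrite w1 perm1.
have -> : wF.1 (0, 0, 0, 1) = (0, 1, 1, 1) by apply/eqP; vm_compute.
have n1 : (1 < n)%N by lia.
by move=> /ffunP/(_ (Ordinal n1)); rewrite !ffunE.
Qed.

End Computation.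

(** * The witness as a pure braid *)

Section Pure.

Variable n : nat.
Local Notation B := (braid_group n).
Local Notation "''s_' i" :=
  (pgen (@braid_rel n) i : B) (at level 8, i at level 2).

Lemma braid_gen_adj (i j : 'I_n.-1) : j = i.+1 :> nat ->
  's_i * 's_j * 's_i = 's_j * 's_i * 's_j.
Proof.
move=> ij; have /PresRel/pclassP := BraidAdj ij.
by rewrite -!pclassM !mulgA.
Qed.

Lemma braid_gen_far (i j : 'I_n.-1) : i.+2 <= j -> commute 's_i 's_j.
Proof.
move=> ij; have /(@BraidFar n)/PresRel/pclassP : (i.+2 <= j) || (j.+2 <= i).
  by rewrite ij.
by rewrite -!pclassM => /esym.
Qed.

Lemma pure_square (i : 'I_n.-1) (g : B) :
  ker_pred (@braid_perm n) (('s_i ^+ 2) ^ g).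
Proof.
rewrite /ker_pred gmulfJ gmulfXn /= braid_perm_gen expg2 /adj_tperm tperm2.
by rewrite conj1g.
Qed.

Definition pure_gen (i : 'I_n.-1) (g : B) : pure_braid_group n :=
  exist _ (('s_i ^+ 2) ^ g) (pure_square i g).

End Pure.

Theorem theorem4p2 (n : nat) (hn : 4 <= n) :
  ~ residually_free (pure_braid_group n).
Proof.
have [lt0 lt1 lt2] : [/\ 0 < n.-1, 1 < n.-1 & 2 < n.-1] by split; lia.
pose i0 := Ordinal lt0; pose i1 := Ordinal lt1; pose i2 := Ordinal lt2.
pose a := pgen (@braid_rel n) i0 : braid_group n.
pose b := pgen (@braid_rel n) i1 : braid_group n.
pose c := pgen (@braid_rel n) i2 : braid_group n.
have aba : a * b * a = b * a * b by apply: braid_gen_adj.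
have bcb : b * c * b = c * b * c by apply: braid_gen_adj.
have ac : commute a c by apply: braid_gen_far.
pose a12 := pure_gen i0 1; pose a13 := pure_gen i0 b.
pose a14 := pure_gen i0 (b * c).
pose a23 := pure_gen i1 1; pose a24 := pure_gen i1 c; pose a34 := pure_gen i2 1.
have v12 : val a12 = a ^+ 2 by rewrite /= conjg1.
have v23 : val a23 = b ^+ 2 by rewrite /= conjg1.
have v34 : val a34 = c ^+ 2 by rewrite /= conjg1.
have v13 : val a13 = (a ^+ 2) ^ b by [].
have v24 : val a24 = (b ^+ 2) ^ c by [].
have v14 : val a14 = (a ^+ 2) ^ (b * c) by [].
move/(_ (witness a12 a14 a23 a34)) => [].
  have wC := @witness_colouring n hn i0 i1 i2 erefl erefl erefl.
  apply: contra_neq wC.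
  move=> /(congr1 val) /(congr1 (@braid_colouring n)).
  rewrite !gmulf_witness gmulf1 /= !conjg1.
  by rewrite gmulfJ (gmulfM b c) !gmulfXn /= !braid_colouring_gen.
move=> X [f fw].
have [h] := free_group_residually_SL2Z fw; apply/negP; rewrite negbK.
pose k : pure_braid_group n -> SL2Z := h \o f.
have kM : {morph k : x y / x * y} by move=> x y; rewrite /k /= !gmulfM.
have k1 : k 1 = 1 by apply: (mulgI (k 1)); rewrite -kM !mulg1.
pose K : UMagmaMorphism.type (pure_braid_group n) SL2Z :=
  HB.pack_for (UMagmaMorphism.type (pure_braid_group n) SL2Z) k
    (isMultiplicative.Build _ _ k kM)
    (Multiplicative_isUMagmaMorphism.Build _ _ k k1).
change (K (witness a12 a14 a23 a34) == 1).
rewrite gmulf_witness.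
have Kcomm x y : commute (val x) (val y) -> commute (K x) (K y).
  by move=> xy; apply/gmulf_commute/val_inj; rewrite !valM.
have Ktwist x y z : twist_commutes (val x) (val y) (val z) ->
    twist_commutes (K x) (K y) (K z).
  by rewrite /twist_commutes -!gmulfM => -[? ? ?]; split; apply: Kcomm.
have [zA zB zC] := four_strand_twist aba bcb ac.
pose z := a34 * a24 * a14 * (a23 * a13 * a12).
have zE : val z = c ^+ 2 * (b ^+ 2) ^ c * (a ^+ 2) ^ (b * c) *
    (b ^+ 2 * (a ^+ 2) ^ b * a ^+ 2) by rewrite !valM v12 v13 v14 v23 v24 v34.
rewrite -zE in zA zB zC.
apply/eqP/(@witness_eq1 _ _ (K a13) _ _ (K a24)).
- exact: SL2Z_centralizers_abelian.
- by apply: Kcomm; rewrite v14 v23; apply: commute_14_23.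
- by apply: Ktwist; rewrite v23 v13 v12; apply: three_strand_twist.
- by apply: Ktwist; rewrite v24 v14 v12; apply: twist_124.
- by apply: Ktwist; rewrite v34 v24 v23; apply: three_strand_twist.
- rewrite -!gmulfM -/z; apply: Kcomm; rewrite v12; exact: commuteX.
rewrite -!gmulfM -/z; apply: Kcomm; rewrite v14 conjgE.
do ?[apply: commuteM | apply: commuteV | apply: commuteX]; by [].
Qed.
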